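(* Let $k,\omega,\Omega,k_p,k_I$ be real numbers and let $$\tilde{\mathbf A}=\begin{pmatrix}0&1&0\\ k_p+\Omega^2-\omega^2&-(2k\omega+i\,2\Omega)&k_I\\ 1&0&0\end{pmatrix}\in\mathbb{C}^{3\times 3}.$$ Then $\tilde{\mathbf A}$ is stable if and only if the following three conditions are all satisfied: $$2k\omega>0,$$ $$2k\omega\left[2k\omega(\omega^2-\Omega^2-k_p)+k_I\right]>0,$$ $$-8k_I^2k\omega\Omega^2-k_I\left[2k\omega(\omega^2-\Omega^2-k_p)+k_I\right]^2>0.$$
   Context: Here $i$ is the imaginary unit, and a square complex matrix is called stable if all its eigenvalues have strictly negative real part. The matrix $\tilde{\mathbf A}$ is the closed-loop matrix, in the variables $(x,\dot x,\ell)$, of the rotating shaft model $\ddot x(t)+(2k\omega+i\,2\Omega)\dot x(t)+(\omega^2-\Omega^2)x(t)=u(t)$ under the PI control $u(t)=k_p(x(t)-x_r)+k_I\ell(t)$, $\dot\ell(t)=x(t)-x_r$, where $x_r$ is a constant reference. *)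

(* Defs.v *)
From HB Require Import structures.
From mathcomp Require Import all_boot all_order all_algebra.
From mathcomp Require Import reals.
From mathcomp Require Import complex.

Set Implicit Arguments.
Unset Strict Implicit.
Unset Printing Implicit Defensive.

Import Order.TTheory GRing.Theory Num.Theory.
Local Open Scope ring_scope.
Local Open Scope complex_scope.

(* [eigenvalue] speaks of left (row) eigenvectors; for a square matrix these
   have the same eigenvalues as the right ones. *)
Definition stable_mx (R : realType) (n : nat) (A : 'M[R[i]]_n) : Prop :=
  forall z : R[i], eigenvalue A z -> complex.Re z < 0.

(* Closed-loop matrix of the rotating shaft, in the variables
   (x, dx/dt, l), under u = kp (x - xr) + kI l and dl/dt = x - xr. *)
Definition shaft_closed_loop_mx (R : realType) (k omega Omega kp kI : R) :
    'M[R[i]]_3 :=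
  \matrix_(i < 3, j < 3)
    nth 0 (nth [::]
      [:: [:: 0; 1; 0];
          [:: (kp + Omega ^+ 2 - omega ^+ 2)%:C;
              - ((2 * k * omega)%:C + 'i%C * (2 * Omega)%:C);
              kI%:C];
          [:: 1; 0; 0]] i) j.

(* Main.v *)
(** The characteristic polynomial is [p = z^3 + (a + i b) z^2 + c z + d] with
    [a], [b], [c], [d] real, and the three conditions say that the leading
    principal minors of its Hermite form are positive.  Split [p = f + g] with
    [f = a z^2 + d].  Then [Re (f * conj g) = Re z * H(z)], where [H] is, up to
    a factor, the Hermite form on the vector [(z^2, z, 1)].  At a root
    [Re (f * conj g) = - |f|^2], so positivity of [H] forces [Re z < 0].
    Conversely, peeling off the roots [z_j] one at a time writes [H] as a sum
    of squares weighted by [- Re z_j], and Cauchy-Binet then gives its minors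
    as explicit positive expressions in the roots. *)

Require Import Defs.
From HB Require Import structures.
From mathcomp Require Import all_boot all_order all_algebra.
From mathcomp Require Import reals.
From mathcomp Require Import complex.
From mathcomp Require Import ring lra.

Set Implicit Arguments.
Unset Strict Implicit.
Unset Printing Implicit Defensive.

Import Order.TTheory GRing.Theory Num.Theory.
Local Open Scope ring_scope.

Lemma cubic_root_Re_lt0 (F : realFieldType) (a b c d x y : F) :
  0 < a -> 0 < d -> 0 < a * c - d ->
  a * d * b ^+ 2 < (a * c - d) ^+ 2 ->
  x ^+ 3 - 3 * x * y ^+ 2 + a * (x ^+ 2 - y ^+ 2) - 2 * b * x * y + c * x + d
    = 0 ->
  3 * x ^+ 2 * y - y ^+ 3 + 2 * a * x * y + b * (x ^+ 2 - y ^+ 2) + c * y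
    = 0 ->
  x < 0.
Proof.
move=> a0 d0 e0 D0 Re0 Im0; rewrite ltNge; apply/negP => x0.
set e := a * c - d in e0 D0; pose u := a * (x ^+ 2 - y ^+ 2) + d.
pose v := 2 * a * x * y.
(* [M] is the form [H] with squares completed, where [u + i v = f(z)] and [z = x + i y]; the
   constant left over is positive by the third minor. *)
pose M := (u ^+ 2 + v ^+ 2) / a + e * x ^+ 2 + e * (y - b * d / e) ^+ 2
          + d * (e ^+ 2 - a * d * b ^+ 2) / (a * e).
have a_neq0 : a != 0 by rewrite gt_eqF.
have e_neq0 : e != 0 by rewrite gt_eqF.
have M0 : 0 < M.
  have pos : 0 < d * (e ^+ 2 - a * d * b ^+ 2) / (a * e).
    by rewrite divr_gt0 ?mulr_gt0 // subr_gt0.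
  apply: ltr_wpDl => //; apply: addr_ge0; first apply: addr_ge0.
  - by rewrite divr_ge0 ?addr_ge0 ?sqr_ge0 // ltW.
  - by rewrite mulr_ge0 ?sqr_ge0 // ltW.
  - by rewrite mulr_ge0 ?sqr_ge0 // ltW.
have xM : x * M + (u ^+ 2 + v ^+ 2) = 0.
  move: Re0 Im0; set P := (X in X = 0 -> _); set Q := (X in _ -> X = 0 -> _).
  (* As [P + i Q = p(z)], the right-hand side is [Re (p * conj f)]. *)
  move=> P0 Q0; have -> : x * M + (u ^+ 2 + v ^+ 2) = P * u + Q * v.
    rewrite /M /P /Q /u /v /e; field.
    by rewrite a_neq0 e_neq0.
  by rewrite P0 Q0 !mul0r addr0.
have x_eq0 : x = 0.
  apply/eqP; rewrite eq_le x0 andbT -(pmulr_rle0 x M0) mulrC.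
  by have := sqr_ge0 u; have := sqr_ge0 v; lra.
(* A root on the imaginary axis would force [e = a * b * y] with [a * y ^+ 2 = d], so the third
   minor would vanish. *)
move: Re0 Im0; rewrite x_eq0 => Re0 Im0.
have yd : a * y ^+ 2 = d by lra.
have y_neq0 : y != 0.
  by apply: contraTneq d0 => y_eq0; rewrite -yd y_eq0 expr0n mulr0 ltxx.
have by_e : a * b * y = e.
  apply: (mulfI y_neq0).
  have cy : c * y = b * y ^+ 2 + y ^+ 3 by lra.
  have -> : y * e = a * (c * y) - y * d by rewrite /e; ring.
  by rewrite cy -yd; ring.
move: D0; rewrite -by_e -yd; apply/negP; rewrite -leNgt.
by rewrite le_eqVlt; apply/orP; left; apply/eqP; ring.
Qed.

(* The two hypotheses with right-hand side 0 say that the coefficient of z and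
   the constant term of the cubic with roots x_j + i y_j are real.  The minors
   [minor2] and [minor3] are those of a cubic with arbitrary complex coefficients
   z^3 + (a + i b) z^2 + (c + i g) z + (d - i h): in that form they are polynomial
   identities in the roots. *)
Lemma cubic_hermite_minors_gt0 (F : realFieldType)
    (x1 y1 x2 y2 x3 y3 a b c d : F) :
  x1 < 0 -> x2 < 0 -> x3 < 0 ->
  a = - (x1 + x2 + x3) -> b = - (y1 + y2 + y3) ->
  c = x1 * x2 - y1 * y2 + (x1 * x3 - y1 * y3) + (x2 * x3 - y2 * y3) ->
  x1 * y2 + y1 * x2 + (x1 * y3 + y1 * x3) + (x2 * y3 + y2 * x3) = 0 ->
  d = - ((x1 * x2 - y1 * y2) * x3 - (x1 * y2 + y1 * x2) * y3) ->
  (x1 * x2 - y1 * y2) * y3 + (x1 * y2 + y1 * x2) * x3 = 0 ->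
  [/\ 0 < a, 0 < a * (a * c - d)
    & 0 < d * (a * c - d) ^+ 2 - a * d ^+ 2 * b ^+ 2].
Proof.
move=> x1N x2N x3N aE bE cE g0 dE h0.
set g := (LHS) in g0; set h := (LHS) in h0.
(* [S] is [|z + conj z'|^2]. *)
pose S (x y x' y' : F) := (x + x') ^+ 2 + (y - y') ^+ 2.
have S_gt0 x y x' y' : x < 0 -> x' < 0 -> 0 < S x y x' y'.
  move=> xN x'N; apply: ltr_wpDr; first exact: sqr_ge0.
  by rewrite exprn_even_gt0 //= lt_eqF //; lra.
(* Cauchy-Binet: one term per pair of roots. Root 2 is peeled off between roots 1 and 3, whence the
   [2 * x2] in the last term. *)
have minor2 : a * (a * c + g * b - d) - g ^+ 2 =
    x2 * x3 * S x2 y2 x3 y3 + x1 * x2 * S x1 y1 x2 y2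
    + x1 * x3 * ((x1 + 2 * x2 + x3) ^+ 2 + (y1 - y3) ^+ 2).
  by rewrite aE bE cE dE /g /S; ring.
have minor3 :
  let m1 := a * c + g * b - d in let m0 := d * c - g * h in
  let t := b * d + h * a in
  a * (m1 * m0 - t ^+ 2) - g ^+ 2 * m0 + 2 * d * g * t - d ^+ 2 * m1 =
  - (x1 * x2 * x3) * (S x1 y1 x2 y2 * S x1 y1 x3 y3 * S x2 y2 x3 y3).
  by rewrite /= aE bE cE dE /g /h /S; ring.
split; first by rewrite aE; lra.
- move: minor2; rewrite g0 => E.
  have -> : a * (a * c - d) = a * (a * c + 0 * b - d) - 0 ^+ 2 by ring.
  rewrite E; apply: ltr_wpDr.
    by rewrite mulr_ge0 ?addr_ge0 ?sqr_ge0 // ltW // nmulr_rgt0.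
  by rewrite addr_gt0 // mulr_gt0 ?S_gt0 // nmulr_rgt0.
- move: minor3; rewrite /= g0 h0 => E.
  rewrite (_ : _ - _ = - (x1 * x2 * x3) *
    (S x1 y1 x2 y2 * S x1 y1 x3 y3 * S x2 y2 x3 y3)); last by rewrite -E; ring.
  by rewrite !mulr_gt0 ?S_gt0 // oppr_gt0 pmulr_rlt0 // nmulr_rgt0.
Qed.

(** Vieta's formulas for the roots of [z^3 + b z^2 + c z + d]. *)
Lemma cubic_split (F : closedFieldType) (b c d : F) :
  exists z1 z2 z3 : F,
    [/\ b = - (z1 + z2 + z3), c = z1 * z2 + z1 * z3 + z2 * z3
      & d = - (z1 * z2 * z3)].
Proof.
pose p := Poly [:: d; c; b; 1].
have pE : p = [:: d; c; b; 1] :> seq F by rewrite (PolyK (c := 0)) //= oner_neq0.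
have [r] := closed_field_poly_normal p.
rewrite lead_coefE pE /= scale1r => pr.
have : size r = 3 by apply: succn_inj; rewrite -(size_prod_XsubC r id) -pr pE.
case: r pr => [|z1 [|z2 [|z3 []]]] //= pr _; exists z1, z2, z3.
move: pr; rewrite !big_cons big_nil => pr.
have pr' : p = 'X^3 + (- (z1 + z2 + z3))%:P * 'X^2
   + (z1 * z2 + z1 * z3 + z2 * z3)%:P * 'X + (- (z1 * z2 * z3))%:P.
  by rewrite pr; ring.
have co i : p`_i = [:: d; c; b; 1]`_i by rewrite pE.
by split; [have := co 2 | have := co 1 | have := co 0];
  rewrite pr' !coefD !coefCM !coefC !coefXn !coefX /= => <-; ring.
Qed.

Lemma det_mx33 (R : comNzRingType) (A : 'M[R]_3) :
  let e (i j : nat) := A (inord i) (inord j) in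
  \det A = e 0 0 * (e 1 1 * e 2 2 - e 1 2 * e 2 1)
         - e 0 1 * (e 1 0 * e 2 2 - e 1 2 * e 2 0)
         + e 0 2 * (e 1 0 * e 2 1 - e 1 1 * e 2 0).
Proof.
move=> e; have Ae i j : A i j = e i j by rewrite /e !inord_val.
rewrite (expand_det_row _ 0) !big_ord_recl big_ord0 /cofactor.
rewrite !(fun B : 'M[R]_2 => expand_det_row B 0) !big_ord_recl !big_ord0.
by rewrite /cofactor !det_mx11 !mxE !Ae /=; ring.
Qed.

Lemma eigenvalue_shaft (R : realType) (k omega Omega kp kI : R) (z : R[i]) :
  eigenvalue (shaft_closed_loop_mx k omega Omega kp kI) z =
  (z ^+ 3 + ((2 * k * omega) +i* (2 * Omega))%C * z ^+ 2
    + (omega ^+ 2 - Omega ^+ 2 - kp)%:C%C * z + (- kI)%:C%C == 0).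
Proof.
rewrite eigenvalue_root_char /root; congr (_ == 0).
have -> : ((2 * k * omega) +i* (2 * Omega))%C =
    (2 * k * omega)%:C%C + 'i%C * (2 * Omega)%:C%C :> R[i].
  by rewrite [LHS]complexE.
have -> : (omega ^+ 2 - Omega ^+ 2 - kp)%:C%C =
    - (kp + Omega ^+ 2 - omega ^+ 2)%:C%C :> R[i].
  by rewrite -rmorphN; congr _%:C%C; ring.
rewrite rmorphN /= /char_poly det_mx33 !mxE -!val_eqE /= !inordK //=.
move: ((2 * k * omega)%:C%C + _) (kp + _ - _)%:C%C kI%:C%C => b m q.
rewrite !(mulr1n, mulr0n).
rewrite [X in X.[_]](_ : _ = 'X^3 + b *: 'X^2 - m *: 'X - q%:P); last first.
  by rewrite -!mul_polyC; ring.
rewrite !(hornerD, hornerN, hornerZ, hornerXn, hornerX, hornerC).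
ring.
Qed.

Theorem mainTheorem2 (R : realType) (k omega Omega kp kI : R) :
  stable_mx (shaft_closed_loop_mx k omega Omega kp kI) <->
  [/\ 0 < 2 * k * omega,
      0 < 2 * k * omega *
          (2 * k * omega * (omega ^+ 2 - Omega ^+ 2 - kp) + kI)
    & 0 < - 8 * kI ^+ 2 * k * omega * Omega ^+ 2
          - kI * (2 * k * omega * (omega ^+ 2 - Omega ^+ 2 - kp) + kI) ^+ 2].
Proof.
have := @eigenvalue_shaft R k omega Omega kp kI.
rewrite /stable_mx; set A := shaft_closed_loop_mx _ _ _ _ _ => Ap.
set a := 2 * k * omega in Ap *; set c := omega ^+ 2 - Omega ^+ 2 - kp in Ap *.
(* The constant term is [d = - kI]. With [b = 2 * Omega], the third condition becomes the minor
   [d (a c - d)^2 - a d^2 b^2]. *)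
rewrite -[kI in a * c + kI]opprK.
have -> : - 8 * kI ^+ 2 * k * omega * Omega ^+ 2 - kI * (a * c - - kI) ^+ 2 =
    - kI * (a * c - - kI) ^+ 2 - a * (- kI) ^+ 2 * (2 * Omega) ^+ 2.
  by rewrite /a; ring.
move: (2 * Omega) (- kI) Ap => b d Ap.
clearbody A a c; split=> [stA | [a0 e0 D0] [x y]].
- have [z1 [z2 [z3 [bE cE dE]]]] := cubic_split (a +i* b)%C c%:C%C d%:C%C.
  have factor z : z ^+ 3 + (a +i* b)%C * z ^+ 2 + c%:C%C * z + d%:C%C =
      (z - z1) * (z - z2) * (z - z3) by rewrite bE cE dE; ring.
  have := stA z1; have := stA z2; have := stA z3.
  rewrite !Ap !factor !subrr !(mul0r, mulr0) eqxx.
  move=> /(_ isT) + /(_ isT) + /(_ isT).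
  move: z1 z2 z3 bE cE dE {factor} => [x1 y1] [x2 y2] [x3 y3] /=.
  move=> [aE bE] [cE gE] [dE hE] x3N x2N x1N.
  apply: (@cubic_hermite_minors_gt0 _ x1 y1 x2 y2 x3 y3) => //; lra.
- have ac_d : 0 < a * c - d by rewrite pmulr_rgt0 in e0.
  (* The third condition gives [d (a c - d)^2 > a d^2 b^2 >= 0], which fixes the sign of [d]; a
     factor [d] can then be cancelled. *)
  have d0 : 0 < d.
    rewrite -(pmulr_lgt0 _ (exprn_gt0 2 ac_d)).
    apply: lt_le_trans D0 _; rewrite gerBl.
    by rewrite mulr_ge0 ?sqr_ge0 // mulr_ge0 ?sqr_ge0 // ltW.
  rewrite Ap => /eqP[Re0 Im0] /=.
  apply: (@cubic_root_Re_lt0 _ a b c d x y) => //.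
  + rewrite -subr_gt0 -(pmulr_rgt0 _ d0); apply: lt_le_trans D0 _.
    by rewrite le_eqVlt; apply/orP; left; apply/eqP; ring.
  + by rewrite -[RHS]Re0; ring.
  + by rewrite -[RHS]Im0; ring.
Qed.
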